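(* For each integer $m\geq 2$, there exists an exact $m$-cover of $\mathbb{Z}$ which is not the union of two $1$-covers.
   Context: For an integer $a$ and a positive integer $n$, let $a(n)=\{x\in\mathbb{Z}: x\equiv a \pmod{n}\}$. A finite system $\mathcal{A}=\{a_t(n_t)\}_{t=1}^s$ is a finite indexed family of such residue classes (repetitions allowed, counted with multiplicity). Its covering function is $w_{\mathcal{A}}(x)=|\{1\leq t\leq s: x\in a_t(n_t)\}|$ for $x\in\mathbb{Z}$. The system $\mathcal{A}$ is an $m$-cover of $\mathbb{Z}$ if $w_{\mathcal{A}}(x)\geq m$ for every $x\in\mathbb{Z}$, and an exact $m$-cover of $\mathbb{Z}$ if $w_{\mathcal{A}}(x)=m$ for every $x\in\mathbb{Z}$. A system $\mathcal{A}=\{a_t(n_t)\}_{t=1}^s$ is the union of two $1$-covers if the index set $\{1,\ldots,s\}$ can be split into two disjoint subsets $I_1,I_2$ with $I_1\cup I_2=\{1,\ldots,s\}$ such that both $\{a_t(n_t)\}_{t\in I_1}$ and $\{a_t(n_t)\}_{t\in I_2}$ are $1$-covers of $\mathbb{Z}$. *)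

(* Defs.v *)
From mathcomp Require Import all_boot all_order all_algebra.

Set Implicit Arguments.
Unset Strict Implicit.
Unset Printing Implicit Defensive.

Definition residue_class (a : int) (n : nat) : pred int :=
  fun x => (x == a %[mod n])%Z.

(* Being indexed, a system may contain the same residue class several times. *)
Record system (T : finType) := System {
  residue : T -> int;
  modulus : T -> nat;
  modulus_gt0 : forall t, 0 < modulus t
}.

Definition covering_function (T : finType) (A : system T) (x : int) : nat :=
  #|[set t : T | residue_class (residue A t) (modulus A t) x]|.

Definition is_cover (m : nat) (T : finType) (A : system T) : Prop :=
  forall x : int, m <= covering_function A x.

Definition is_exact_cover (m : nat) (T : finType) (A : system T) : Prop :=
  forall x : int, covering_function A x = m.

Definition subsystem (T : finType) (A : system T) (I : {set T}) :
    system {t : T | t \in I} :=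
  @System _ (fun t => residue A (val t)) (fun t => modulus A (val t))
    (fun t => modulus_gt0 A (val t)).

Definition union_of_two_1covers (T : finType) (A : system T) : Prop :=
  exists I1 I2 : {set T},
    [/\ [disjoint I1 & I2], I1 :|: I2 = [set: T],
        is_cover 1 (subsystem A I1) & is_cover 1 (subsystem A I2)].

(* Main.v *)
(* The cover is built from a graph G in which every 2-colouring of
   the vertices has a monochromatic m-clique although G has no (m+1)-clique
   (Folkman's theorem for vertices).  Attach to each vertex of G a residue class
   so that two classes are disjoint exactly when the vertices are distinct and
   nonadjacent: each nonadjacent pair gets a private prime modulo which its two
   vertices have the residues 0 and 1.  The classes through an integer then form
   a clique, so nothing is covered more than m times, and by the Chinese
   remainder theorem each clique has a common point.  Adding classes modulo the
   product of the moduli gives an exact m-cover, in which a common point of an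
   m-clique lies in no other class; splitting the cover 2-colours G, and the part
   that misses the colour of a monochromatic m-clique misses its common point. *)

Require Import Defs.
From mathcomp Require Import all_boot all_order all_algebra.

(** * Cliques and Folkman's theorem for vertices *)

Definition clique {V : finType} (e : rel V) (K : {set V}) : bool :=
  [forall x in K, forall y in K, (x != y) ==> e x y].

Definition has_clique {V : finType} (e : rel V) (k : nat) (P : {set V}) : bool :=
  [exists K : {set V}, [&& K \subset P, clique e K & #|K| == k]].

Lemma cliqueP {V : finType} {e : rel V} {K : {set V}} :
  reflect {in K &, forall x y, x != y -> e x y} (clique e K).
Proof.
apply: (iffP 'forall_in_'forall_in_implyP) => h x y xK yK; first exact: h.
exact: h.
Qed.

Lemma has_cliqueP {V : finType} {e : rel V} {k : nat} {P : {set V}} :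
  reflect (exists K : {set V}, [/\ K \subset P, clique e K & #|K| = k])
    (has_clique e k P).
Proof.
apply: (iffP existsP) => -[K]; first by case/and3P=> ? ? /eqP; exists K.
by case=> KP clK /eqP cardK; exists K; apply/and3P.
Qed.

(* Zykov-style step from "an a-clique in P or an m-clique outside P" to a+1: take
   m copies of the graph and, for each choice f of one set per copy, a new
   m-clique whose i-th vertex is joined to f i.  If no copy has an m-clique
   outside P, let f choose an a-clique inside P in each copy; either some new
   vertex over f is in P and extends its f i, or all of them lie outside P. *)
Section FolkmanStep.
Variables (m : nat) (V : finType) (e : rel V).

Definition folkman_vertex : finType :=
  ('I_m * V + {ffun 'I_m -> {set V}} * 'I_m)%type.

Definition folkman_rel : rel folkman_vertex := fun x y =>
  match x, y with
  | inl p, inl q => (p.1 == q.1) && e p.2 q.2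
  | inl p, inr k | inr k, inl p =>
      [&& p.1 == k.2, p.2 \in k.1 k.2 & #|k.1 k.2| < m]
  | inr k, inr l => k.1 == l.1
  end.

(** A clique without new vertices lies in one copy; in one made of new vertices only, all share the
    same [f]; a mixed one consists of a single new vertex [(f, i)] and a part of copy [i] of [f i],
    where the guard [#|k.1 k.2| < m] leaves room for that vertex. So [f] may take arbitrary sets as
    values. *)
Lemma folkman_rel_clique_le :
  (forall K, clique e K -> #|K| <= m) ->
  forall Q, clique folkman_rel Q -> #|Q| <= m.
Proof.
move=> clq_le Q /cliqueP clQ.
have [[f i] fiQ|noQr] := pickP (fun k => inr k \in Q); last first.
  have [->|[[[i x]|k]]] := set_0Vmem Q; first by rewrite cards0.
    2: by rewrite noQr.
  move=> ixQ.
  pose C := [set y | inl (i, y) \in Q].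
  have QC : Q \subset [set inl (i, y) | y in C].
    apply/subsetP => -[[j y]|k] zQ; last by rewrite noQr in zQ.
    suff ij : i = j by subst j; apply: imset_f; rewrite inE.
    have [[->] //|ne] := eqVneq (inl (i, x) : folkman_vertex) (inl (j, y)).
    by have /andP[/eqP] := clQ _ _ ixQ zQ ne.
  apply: leq_trans (subset_leq_card QC) (leq_trans (leq_imset_card _ _) _).
  apply/clq_le/cliqueP => y z; rewrite !inE => yQ zQ ne.
  have [|//] := andP (clQ _ _ yQ zQ _).
  by apply: contra_neq ne => -[].
have [[j x] jxQ|noQl] := pickP (fun p => inl p \in Q).
  have /and3P[/eqP/= ij xf fm] := clQ _ _ fiQ jxQ isT.
  have QC : Q \subset inr (f, i) |: [set inl (i, y) | y in f i].
    apply/subsetP => -[[k y]|[g k]] zQ; rewrite inE.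
      have /and3P[/eqP/= -> yf _] := clQ _ _ fiQ zQ isT.
      by rewrite [X in _ || X]imset_f ?orbT.
    have /and3P[/eqP/= jk _ _] := clQ _ _ zQ jxQ isT.
    have [[-> ->] | ne] := eqVneq (inr (f, i) : folkman_vertex) (inr (g, k)).
      by rewrite inE eqxx.
    by have /eqP/= -> := clQ _ _ fiQ zQ ne; rewrite -jk ij inE eqxx.
  apply: leq_trans (subset_leq_card QC) (leq_trans _ fm).
  by rewrite cardsU1 -add1n leq_add ?leq_b1 // leq_imset_card.
have QC : Q \subset [set inr (f, k) | k in 'I_m].
  apply/subsetP => -[p|[g k]] zQ; first by rewrite noQl in zQ.
  suff -> : g = f by apply: imset_f.
  have [[-> _] //| ne] := eqVneq (inr (f, i) : folkman_vertex) (inr (g, k)).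
  by have /eqP/= -> := clQ _ _ fiQ zQ ne.
apply: leq_trans (subset_leq_card QC) (leq_trans (leq_imset_card _ _) _).
by rewrite card_ord.
Qed.

Lemma folkman_rel_arrow a :
  a < m ->
  (forall P, has_clique e a P || has_clique e m (~: P)) ->
  forall P, has_clique folkman_rel a.+1 P || has_clique folkman_rel m (~: P).
Proof.
move=> am arrow P.
pose copy i (x : V) : folkman_vertex := inl (i, x).
have copy_inj i : injective (copy i) by move=> x y [].
have copy_clique i K : clique e K -> clique folkman_rel (copy i @: K).
  move=> /cliqueP clK; apply/cliqueP => _ _ /imsetP[x xK ->] /imsetP[y yK ->] ne.
  by rewrite /= eqxx /= clK //; apply: contra_neq ne => ->.
have [/existsP[i /has_cliqueP[K [KP clK cardK]]]|/existsPn noblue] :=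
    boolP [exists i, has_clique e m (~: (copy i @^-1: P))].
  apply/orP; right; apply/has_cliqueP.
  exists (copy i @: K); split; last by rewrite card_imset.
    apply/subsetP => _ /imsetP[x xK ->].
    by move/subsetP/(_ _ xK): KP; rewrite !inE.
  exact: copy_clique.
have red i : has_clique e a (copy i @^-1: P).
  by move: (arrow (copy i @^-1: P)); rewrite (negPf (noblue i)) orbF.
pose f : {ffun 'I_m -> {set V}} := [ffun i => xchoose (existsP (red i))].
have fP i : [/\ f i \subset copy i @^-1: P, clique e (f i) & #|f i| = a].
  by rewrite ffunE; have /and3P[? ? /eqP] := xchooseP (existsP (red i)).
have [/existsP[i fiP]|/existsPn noP] := boolP [exists i, inr (f, i) \in P].
  have [fi_sub fi_cl fi_card] := fP i.
  apply/orP; left; apply/has_cliqueP.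
  exists (inr (f, i) |: (copy i @: f i)); split.
  - apply/subsetP => z /setU1P[->//|/imsetP[x xf ->]].
    by move/subsetP/(_ _ xf): fi_sub; rewrite inE.
  - apply/cliqueP => y z /setU1P[->|yf] /setU1P[->|zf]; rewrite ?eqxx //.
    + by case/imsetP: zf => x xf -> _ /=; rewrite eqxx xf fi_card.
    + by case/imsetP: yf => x xf -> _ /=; rewrite eqxx xf fi_card.
    by move=> ne; apply: (cliqueP (copy_clique i _ fi_cl)).
  rewrite cardsU1 card_imset // fi_card.
  by case: imsetP => [[]|].
apply/orP; right; apply/has_cliqueP; exists [set inr (f, i) | i in 'I_m]; split.
- by apply/subsetP => _ /imsetP[i _ ->]; rewrite inE noP.
- by apply/cliqueP => _ _ /imsetP[i _ ->] /imsetP[j _ ->] _ /=.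
by rewrite card_imset ?card_ord // => i j [].
Qed.

End FolkmanStep.

(** Induction on [a]: the empty clique exists everywhere, so the graph without vertices serves for
    [a = 0]. *)
Lemma vertex_folkman (m a : nat) : a <= m ->
  exists (V : finType) (e : rel V),
    (forall K, clique e K -> #|K| <= m) /\
    (forall P, has_clique e a P || has_clique e m (~: P)).
Proof.
elim: a => [_|a IH am].
  exists 'I_0, (fun _ _ => true); split=> [K _|P].
    by rewrite (leq_trans (max_card _)) ?card_ord.
  apply/orP; left; apply/has_cliqueP; exists set0.
  by rewrite sub0set cards0; split=> //; apply/cliqueP => x; rewrite inE.
have [V [e [cl_le arrow]]] := IH (ltnW am).
exists (folkman_vertex m V), (folkman_rel m V e); split.
  exact: folkman_rel_clique_le.
exact: folkman_rel_arrow.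
Qed.

(** * Coprime moduli and simultaneous congruences *)

Lemma coprime_prodr {I : eqType} (q : I -> nat) (s : seq I) (n : nat) :
  (forall i, i \in s -> coprime n (q i)) -> coprime n (\prod_(i <- s) q i).
Proof.
move=> co; rewrite big_seq; elim/big_rec: _ => [|i x si cox].
  exact: coprimen1.
by rewrite coprimeMr cox co.
Qed.

Lemma dvdn_prod_coprime {I : eqType} (q : I -> nat) (s : seq I) (n : nat) :
    (forall i j, i != j -> coprime (q i) (q j)) -> uniq s ->
  (forall i, i \in s -> q i %| n) -> \prod_(i <- s) q i %| n.
Proof.
move=> co; elim: s => [|i s IH] /=; first by rewrite big_nil dvd1n.
case/andP=> i_s uniq_s dvd; rewrite big_cons Gauss_dvd.
  by rewrite dvd ?mem_head // IH // => j js; rewrite dvd // inE js orbT.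
by apply: coprime_prodr => j js; apply: co; apply: contraNneq i_s => ->.
Qed.

Lemma chinese_finite {I : finType} (q c : I -> nat) :
    (forall i j, i != j -> coprime (q i) (q j)) ->
  exists x, forall i, x = c i %[mod q i].
Proof.
move=> co.
suff [x xP] : exists x, forall i, i \in enum I -> x = c i %[mod q i].
  by exists x => i; apply: xP; rewrite mem_enum.
elim: (enum I) (enum_uniq I) => [|i s IH] /=; first by exists 0.
case/andP=> i_s /IH[x xP].
have co_i : coprime (q i) (\prod_(j <- s) q j).
  by apply: coprime_prodr => j js; apply: co; apply: contraNneq i_s => ->.
exists (chinese (q i) (\prod_(j <- s) q j) (c i) x) => j.
rewrite inE => /predU1P[->|js]; first exact: chinese_modl.
have dvd_q : q j %| \prod_(j <- s) q j.
  by rewrite (big_rem j) //= dvdn_mulr.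
by rewrite -(modn_dvdm _ dvd_q) (chinese_modr co_i) modn_dvdm ?xP.
Qed.

(** Distinct indices receive distinct terms of a strictly increasing sequence of primes. *)
Lemma pairwise_coprime_family (I : finType) :
  exists q : I -> nat,
    (forall i, 1 < q i) /\ (forall i j, i != j -> coprime (q i) (q j)).
Proof.
pose p := fix p (k : nat) := if k is k'.+1 then s2val (prime_above (p k')) else 2.
have p_prime k : prime (p k) by case: k => //= k; case: prime_above.
have p_lt : {homo p : i j / i < j}.
  by apply: homo_ltn => [|i]; [exact: ltn_trans|rewrite /=; case: prime_above].
exists (fun i => p (enum_rank i)); split=> [i|i j ne]; first exact: prime_gt1.
rewrite prime_coprime // dvdn_prime2 //.
case: (ltngtP (enum_rank i) (enum_rank j)) => [/p_lt|/p_lt|/ord_inj/enum_rank_inj].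
- by rewrite ltn_neqAle => /andP[].
- by rewrite ltn_neqAle eq_sym => /andP[].
by move/eqP; rewrite (negPf ne).
Qed.

(** * Residue classes attached to a graph *)

Lemma clique_system (V : finType) (e : rel V) :
  exists A : system V,
    (forall x, clique e [set v | residue_class (residue A v) (modulus A v) x]) /\
    (forall K, clique e K -> exists x, forall v, v \in K ->
       residue_class (residue A v) (modulus A v) x).
Proof.
have [q [q_gt1 q_co]] := pairwise_coprime_family (V * V)%type.
pose sep v := [pred p : V * V |
  [&& p.1 != p.2, ~~ e p.1 p.2 & (v == p.1) || (v == p.2)]].
(* The residue is prescribed modulo every [q p], but [md v] keeps only the pairs in [sep v], so the
   other pairs do not constrain the class of [v]. *)
have res_ex v : exists x, [forall p, x == (v == p.2) %[mod q p]].
  have [x xP] := chinese_finite q (fun p => v == p.2) q_co.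
  by exists x; apply/forallP => p; apply/eqP.
pose res v := xchoose (res_ex v).
have resP v p : res v = (v == p.2) %[mod q p].
  by have /forallP/(_ p)/eqP := xchooseP (res_ex v).
pose md v := \prod_(p <- enum (sep v)) q p.
have md_gt0 v : 0 < md v by apply: prodn_gt0 => p; rewrite ltnW.
exists (@System _ (fun v => Posz (res v)) md md_gt0); split=> [x|K /cliqueP clK] /=.
  apply/cliqueP => u v; rewrite !inE /residue_class /= => xu xv uv.
  (* Otherwise [x] would be both 0 and 1 modulo [q (u, v)], which exceeds 1. *)
  apply: contraT => e_uv.
  have sep_mod w : (w == u) || (w == v) -> (x == res w %[mod md w])%Z ->
      (x = Posz (w == v) %[mod q (u, v)])%Z.
    move=> wuv; rewrite eqz_mod_dvd => dvd_x.
    have /eqP : (x == res w %[mod q (u, v)])%Z.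
      rewrite eqz_mod_dvd; apply: dvdz_trans dvd_x.
      have pw : (u, v) \in enum (sep w) by rewrite mem_enum inE /= uv e_uv.
      by rewrite dvdzE /md (big_rem _ pw) /= dvdn_mulr.
    by move->; rewrite !modz_nat resP.
  have := sep_mod v; rewrite eqxx orbT => /(_ isT xv).
  have := sep_mod u; rewrite eqxx => /(_ isT xu) ->.
  by rewrite (negPf uv) !modz_nat mod0n modn_small.
(* For [v] in [K], a pair in [sep v] has its other vertex outside [K], so there [p.2 \in K] agrees
   with [v == p.2]. *)
have [x xP] := chinese_finite q (fun p => p.2 \in K) q_co.
exists (Posz x) => v vK.
rewrite /residue_class eqz_mod_dvd dvdzE /=.
apply: dvdn_prod_coprime => //; first exact: enum_uniq.
move=> p; rewrite mem_enum inE /= => /and3P[ne e_p v_p].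
suff xv : x = res v %[mod q p].
  have : (Posz x == res v %[mod q p])%Z by rewrite !modz_nat xv.
  by rewrite eqz_mod_dvd dvdzE.
rewrite xP resP; congr (nat_of_bool _ %% _).
case/orP: v_p => /eqP v_p; last by rewrite -v_p vK eqxx.
rewrite v_p (negPf ne); apply: contraNF e_p => p2K.
by apply: clK; rewrite -?v_p // v_p.
Qed.

(** * Exact covers and their splittings *)

Lemma covering_function_mod (T : finType) (A : system T) (N : nat) (x y : int) :
    (forall t, modulus A t %| N) -> (x = y %[mod N])%Z ->
  covering_function A x = covering_function A y.
Proof.
move=> dvdN /eqP; rewrite eqz_mod_dvd => xy.
apply: eq_card => t; rewrite !inE /residue_class.
suff -> : (x = y %[mod modulus A t])%Z by [].
by apply/eqP; rewrite eqz_mod_dvd (dvdz_trans _ xy) // dvdzE dvdN.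
Qed.

(** The covering function has period [N], so it suffices to add each class [r] modulo [N] as often
    as [r] falls short of [m]; [U] indexes these copies. *)
Lemma exact_completion (T : finType) (A : system T) (m : nat) :
    (forall x, covering_function A x <= m) ->
  exists (U : finType) (B : system (T + U)%type),
    [/\ forall t, residue B (inl t) = residue A t,
        forall t, modulus B (inl t) = modulus A t & is_exact_cover m B].
Proof.
move=> cov_le.
pose N := \prod_t modulus A t.
have N_gt0 : 0 < N by apply: prodn_gt0 => t; apply: modulus_gt0.
pose k (r : 'I_N) := m - covering_function A r.
pose U : finType := {r : 'I_N & 'I_(k r)}.
pose res (t : T + U) : int :=
  match t with inl t => residue A t | inr u => tag u end.
pose md (t : T + U) := if t is inl t then modulus A t else N.
have md_gt0 t : 0 < md t by case: t => //= t; apply: modulus_gt0.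
exists U, (@System _ res md md_gt0); split=> // x.
have [r xr] : exists r : 'I_N, (x = r %[mod N])%Z.
  have N_neq0 : Posz N != 0%R by rewrite -lt0n.
  have := ltz_mod x N_neq0; have := modz_ge0 x N_neq0.
  case E : (x %% N)%Z => [n|//] _ n_lt.
  have nN : n < N by [].
  by exists (Ordinal nN); rewrite /= -E modz_mod.
rewrite /covering_function cardsE -sum1_card big_sumType /=.
rewrite sum1_card -[X in X + _]cardsE -/(covering_function A x).
rewrite (covering_function_mod _ A N x r) //; last first.
  by move=> t; rewrite /N (bigD1 t) //= dvdn_mulr.
have -> : \sum_(u : U | residue_class (tag u) N x) 1 = k r.
  have tagE (u : U) : residue_class (tag u) N x = (tag u == r).
    rewrite /residue_class xr !modz_nat !modn_small //.
    by rewrite eq_sym; apply/eqP/eqP => [[/ord_inj]|->].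
  transitivity (\sum_(u : U | (tag u == r) && true) 1).
    by apply: eq_bigl => u; rewrite andbT tagE.
  rewrite -(sig_big_dep (pred1 r) (fun _ => predT) (fun _ _ => 1)).
  by rewrite big_pred1_eq sum1_card card_ord.
by rewrite subnKC.
Qed.

(** If all classes through [x] lie in one part of a splitting, the other part misses [x]. *)
Lemma exact_cover_ordinal (T : finType) (A : system T) (m : nat) :
    is_exact_cover m A ->
    (forall I : {set T}, exists x, 
      [set t | residue_class (residue A t) (modulus A t) x] \subset I \/
      [set t | residue_class (residue A t) (modulus A t) x] \subset ~: I) ->
  exists (s : nat) (B : system 'I_s),
    is_exact_cover m B /\ ~ union_of_two_1covers B.
Proof.
move=> exA unsplit.
pose f : 'I_#|T| -> T := enum_val.
pose B := @System _ (residue A \o f) (modulus A \o f)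
  (fun i => modulus_gt0 A (f i)).
have f_bij : bijective f by apply: enum_val_bij.
exists #|T|, B; split=> [x|[I1 [I2 [dis _ cov1 cov2]]]].
  rewrite -[RHS](exA x) -[RHS](on_card_preimset (onW_bij _ f_bij)).
  by apply: eq_card => i; rewrite !inE.
have [x sub] := unsplit (f @: I1).
have cov_ex (I : {set 'I_#|T|}) : is_cover 1 (subsystem B I) ->
    exists2 i, i \in I &
      f i \in [set t | residue_class (residue A t) (modulus A t) x].
  by move=> /(_ x) /card_gt0P[[i iI]]; rewrite !inE; exists i; rewrite ?inE.
case: sub => /subsetP sub.
  have [i iI2 /sub] := cov_ex _ cov2.
  rewrite (mem_imset _ _ (bij_inj f_bij)) => iI1.
  by move: (disjointFr dis iI1); rewrite iI2.
have [i iI1 /sub] := cov_ex _ cov1.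
by rewrite inE imset_f.
Qed.

Theorem theorem3 : forall m : nat, 2 <= m ->
  exists (s : nat) (A : system 'I_s),
    is_exact_cover m A /\ ~ union_of_two_1covers A.
Proof.
move=> m _.
have [V [e [cl_le arrow]]] := vertex_folkman m m (leqnn m).
have [A [A_clique A_meet]] := clique_system V e.
have [x|U [B [resB modB exB]]] := exact_completion _ A m; first exact: cl_le.
apply: (exact_cover_ordinal _ B m exB) => I.
(* [K] already supplies [m] classes through [x], and [B] covers [x] exactly [m] times, so no other
   class, original or added, contains [x]. *)
have point (K : {set V}) : clique e K -> #|K| = m -> exists x,
    [set t | residue_class (residue B t) (modulus B t) x] = inl @: K.
  move=> clK cardK; have [x xK] := A_meet K clK; exists x.
  apply/esym/eqP; rewrite eqEcard; apply/andP; split.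
    by apply/subsetP => _ /imsetP[v vK ->]; rewrite inE resB modB xK.
  by rewrite card_imset ?cardK ?[X in X <= _]exB // => u v [].
(* The vertices whose indices lie in [I] form one colour. *)
have [/has_cliqueP|/has_cliqueP] := orP (arrow [set v | inl v \in I]);
  move=> [K [/subsetP KI clK cardK]];
  have [x xK] := point K clK cardK; exists x; rewrite xK.
  by left; apply/subsetP => _ /imsetP[v /KI + ->]; rewrite inE.
by right; apply/subsetP => _ /imsetP[v /KI + ->]; rewrite !inE.
Qed.
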